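(* For all $n\geq 2$ and $k\geq 2$, the restricted edge-connectivity of the DCell satisfies $\lambda_2(D_{k,n})=2n+2k-4$.
   Context: DCell $D_{k,n}$ ($n\geq 2$, $k\geq 0$) is defined recursively. $D_{0,n}$ is the complete graph $K_n$ on vertices $0,1,\dots,n-1$. Let $t_{k,n}=|V(D_{k,n})|$. For $k\geq1$, $D_{k,n}$ is built from $t_{k-1,n}+1$ disjoint copies $D^0_{k-1,n},\dots,D^{t_{k-1,n}}_{k-1,n}$ of $D_{k-1,n}$; a vertex of copy $D^i_{k-1,n}$ is labeled $(i,a_{k-1},\dots,a_0)$, where $(a_{k-1},\dots,a_0)$ is its label in $D_{k-1,n}$, and its index within the copy is $uid_{k-1}=a_0+\sum_{l=1}^{k-1}a_l t_{l-1,n}$. For each pair $a<b$ of copy indices, one new edge (a level $k$ edge) joins the vertex of $D^a_{k-1,n}$ with $uid_{k-1}=b-1$ to the vertex of $D^b_{k-1,n}$ with $uid_{k-1}=a$. For a graph $G$ and $m\geq2$, an edge set $F$ is an $m$-restricted edge-cut if $G-F$ is disconnected and every component of $G-F$ has at least $m$ vertices; $\lambda_m(G)$ is the minimum size of an $m$-restricted edge-cut ($\lambda_2$ is the restricted edge-connectivity). *)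

(* Defs.v *)
From HB Require Import structures.
From mathcomp Require Import all_boot.

Set Implicit Arguments.
Unset Strict Implicit.
Unset Printing Implicit Defensive.

(* A simple graph is a symmetric irreflexive relation [e] on a finite type. *)
Section RestrictedEdgeCut.
Variables (T : finType) (e : rel T).

Definition edge_set : {set {set T}} :=
  [set [set p.1; p.2] | p : T * T & e p.1 p.2].

Definition edge_delete (F : {set {set T}}) : rel T :=
  [rel u v | e u v && ([set u; v] \notin F)].

Definition disconnected (r : rel T) : Prop := exists u v : T, ~~ connect r u v.

Definition component (r : rel T) (v : T) : {set T} := [set w | connect r v w].

Definition restricted_edge_cut (m : nat) (F : {set {set T}}) : Prop :=
  [/\ F \subset edge_set,
      disconnected (edge_delete F)
    & forall v : T, m <= #|component (edge_delete F) v|].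

(* lambda_m(e) = l; in particular an m-restricted edge-cut exists. *)
Definition restricted_edge_connectivity_is (m l : nat) : Prop :=
  (exists F : {set {set T}}, restricted_edge_cut m F /\ #|F| = l) /\
  (forall F : {set {set T}}, restricted_edge_cut m F -> l <= #|F|).

End RestrictedEdgeCut.

(* The label (a_k, ..., a_0) is the nested pair (a_k, (..., (a_1, a_0))). *)
Fixpoint dcell_vertex (n k : nat) : finType :=
  if k is k'.+1 then ('I_(#|dcell_vertex n k'|.+1) * dcell_vertex n k')%type
  else 'I_n.

Definition dcell_size (n k : nat) : nat := #|dcell_vertex n k|.

Fixpoint dcell_uid (n k : nat) : dcell_vertex n k -> nat :=
  match k return dcell_vertex n k -> nat with
  | 0 => fun a => a
  | k'.+1 => fun v => dcell_uid v.2 + v.1 * dcell_size n k'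
  end.

Definition dcell_link (n k : nat) (u v : dcell_vertex n k.+1) : bool :=
  [&& u.1 < v.1, dcell_uid u.2 == v.1.-1 & dcell_uid v.2 == u.1].

Fixpoint dcell (n k : nat) : rel (dcell_vertex n k) :=
  match k return rel (dcell_vertex n k) with
  | 0 => fun a b => a != b
  | k'.+1 => fun u v =>
      [|| (u.1 == v.1) && dcell u.2 v.2, dcell_link u v | dcell_link v u]
  end.

Lemma dcell_sizeS n k :
  dcell_size n k.+1 = (dcell_size n k).+1 * dcell_size n k.
Proof. by rewrite /dcell_size /= card_prod card_ord. Qed.

Lemma dcell_sym n k : symmetric (@dcell n k).
Proof.
elim: k => [|k IHk] u v /=; first by rewrite eq_sym.
by rewrite eq_sym IHk [dcell_link u v || _]orbC.
Qed.

Lemma dcell_irr n k : irreflexive (@dcell n k).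
Proof.
elim: k => [|k IHk] u /=; first by rewrite eqxx.
by rewrite IHk andbF /dcell_link ltnn.
Qed.

(* Main.v *)
Require Import Defs.
From mathcomp Require Import all_boot.
From mathcomp Require Import zify.

(* Write d(X) for the number of edges leaving X, and call a copy of D_{k-1,n}
   mixed when X meets it in a nonempty proper subset. Each mixed copy
   contributes at least the edge connectivity n+k-2 of D_{k-1,n} to d(X), and
   each pair of a copy inside X and a copy disjoint from X contributes one. So
   two mixed copies already give 2n+2k-4, and no mixed copy, or one mixed copy
   with the others not all on the same side, gives about t_{k-1,n}. In the
   remaining case X, or its complement, lies inside a single copy; then every
   vertex of X adds one edge of level k, and
   d_{k-1}(X) + |X| >= 2n + 2(k-1) - 2 follows by induction on k. The bound is
   attained by the boundary of any edge. *)

Set Implicit Arguments.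
Unset Strict Implicit.
Unset Printing Implicit Defensive.

(** * Edge cuts and boundaries in an arbitrary graph *)

Lemma sum_pair (I J : finType) (F : I * J -> nat) :
  \sum_p F p = \sum_i \sum_j F (i, j).
Proof. by rewrite pair_bigA; apply: eq_bigr => -[]. Qed.

Section Cut.
Variables (T : finType) (e : rel T).
Implicit Types (X : {set T}) (F : {set {set T}}).

(** Each leaving edge is counted once, oriented outwards from [X]. *)
Definition cut X : nat :=
  \sum_u \sum_v [&& u \in X, v \notin X & e u v].

Lemma cut_setC X : symmetric e -> cut (~: X) = cut X.
Proof.
move=> e_sym; rewrite /cut exchange_big; apply: eq_bigr => u _.
apply: eq_bigr => v _; rewrite !inE negbK e_sym.
by rewrite andbCA.
Qed.

Lemma cut_card X :
  cut X = #|[set p : T * T | [&& p.1 \in X, p.2 \notin X & e p.1 p.2]]|.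
Proof.
rewrite /cut pair_bigA -sum1_card big_mkcond [RHS]big_mkcond /=.
by apply: eq_bigr => p _; rewrite inE; case: ifP => // ->.
Qed.

Definition boundary X : {set {set T}} :=
  [set [set p.1; p.2] | p in
    [set p : T * T | [&& p.1 \in X, p.2 \notin X & e p.1 p.2]]].

(** Membership in [X] tells the two ends of a boundary edge apart, so the unordered pair determines
    the oriented one. *)
Lemma card_boundary X : #|boundary X| = cut X.
Proof.
rewrite cut_card; apply: card_in_imset => -[a b] [c d]; rewrite !inE /=.
move=> /and3P[aX bX _] /and3P[cX dX _] /setP E.
have := E a; have := E b; rewrite !inE !eqxx ?orbT /=.
have -> : (b == c) = false by apply/eqP => bc; rewrite bc cX in bX.
have -> : (a == d) = false by apply/eqP => ad; rewrite -ad aX in dX.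
by rewrite orbF /= => /esym/eqP -> /esym/eqP ->.
Qed.

Lemma edge_delete_sym F : symmetric e -> symmetric (edge_delete e F).
Proof. by move=> e_sym u v; rewrite /edge_delete /= e_sym setUC. Qed.

(** An edge that leaves a component of the graph without [F] must lie in [F], or the component would
    extend across it. *)
Lemma cut_component F u :
  cut (component (edge_delete e F) u) <= #|F|.
Proof.
rewrite -card_boundary; apply/subset_leq_card/subsetP => E /imsetP[[a b] + ->].
rewrite !inE /= => /and3P[ua ub ab]; apply: contraR ub => abF.
by apply: connect_trans ua (connect1 _); rewrite /edge_delete /= ab.
Qed.

Lemma mem_boundary X u v : [set u; v] \in boundary X -> (u \in X) != (v \in X).
Proof.
case/imsetP=> -[a b] /=; rewrite inE /= => /and3P[aX bX _] E.
have : a \in [set u; v] by rewrite E set21.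
have : b \in [set u; v] by rewrite E set22.
case/set2P=> eb; case/set2P=> ea; move: aX bX; rewrite ea eb => uX;
  by rewrite ?uX //= => /negPf->.
Qed.

Lemma component_edge_delete_boundary X u :
  symmetric e -> u \in X ->
  component (edge_delete e (boundary X)) u \subset X.
Proof.
move=> e_sym uX; apply/subsetP => w; rewrite inE => /connectP[p].
elim: p u uX => [|v p IHp] u uX /=; first by move=> _ ->.
move=> /andP[/andP[uv uvF] vp] wp; apply: (IHp v) => //.
by apply: contraR uvF => vX; apply/imsetP; exists (u, v); rewrite ?inE ?uX ?vX.
Qed.

Lemma card_component_gt1 (r : rel T) u v :
  u != v -> r u v -> 1 < #|component r u|.
Proof.
move=> uv ruv; rewrite -[2]/(true.+1) -uv -cards2.
by apply/subset_leq_card/subsetP => w /set2P[]->; rewrite inE ?connect0 ?connect1.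
Qed.

Lemma cut_set1 u : irreflexive e -> cut [set u] = #|[set v | e u v]|.
Proof.
move=> e_irr; rewrite /cut (bigD1 u) //= [X in _ + X]big1 ?addn0; last first.
  by move=> v vu; apply: big1 => w _; rewrite inE (negPf vu).
rewrite -sum1_card [RHS]big_mkcond; apply: eq_bigr => v _.
rewrite !inE eqxx /=; case: eqP => [->|_]; first by rewrite e_irr.
by case: (e u v).
Qed.

(** Each end of the edge loses at least its neighbour at the other end. *)
Lemma cut_edge u v :
    symmetric e -> irreflexive e -> e u v ->
  (cut [set u; v]).+2 <= #|[set w | e u w]| + #|[set w | e v w]|.
Proof.
move=> e_sym e_irr uv; have uNv: u != v by apply: contraTneq uv => ->; rewrite e_irr.
have half a b : e a b -> a != b ->
    (\sum_w [&& a \in [set a; b], w \notin [set a; b] & e a w]).+1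
      <= #|[set w | e a w]|.
  move=> ab aNb; rewrite -[X in _ <= X]sum1_card [X in _ <= X]big_mkcond.
  rewrite (bigD1 b) //= [X in _ <= X](bigD1 b) //= !inE !eqxx orbT ab /= ltnS.
  rewrite add0n; apply: leq_sum => w wb; rewrite !inE (negPf wb) orbF.
  by case: (e a w); rewrite ?andbF ?leq_b1.
have := half u v uv uNv.
have := half v u; rewrite e_sym eq_sym => /(_ uv uNv); rewrite setUC => hv hu.
pose f a := \sum_w [&& a \in [set u; v], w \notin [set u; v] & e a w].
have -> : cut [set u; v] = f u + f v.
  rewrite -[LHS]/(\sum_a f a) (bigD1 u) //= (bigD1 v) 1?eq_sym //= big1 ?addn0 //.
  move=> w /andP[wu wv]; apply: big1 => z _.
  by rewrite !inE (negPf wu) (negPf wv).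
rewrite /f; lia.
Qed.

End Cut.

(** * Vertex numbering, sizes, links and degrees in DCell *)

Lemma dcell_uid_lt n k (x : dcell_vertex n k) : dcell_uid x < dcell_size n k.
Proof.
elim: k x => [|k IHk] /=; first by move=> x; rewrite /dcell_size card_ord.
move=> [i x] /=; rewrite dcell_sizeS.
have := IHk x; have : i <= dcell_size n k by rewrite -ltnS.
by rewrite mulSn => il xl; rewrite -addSn leq_add // leq_mul2r il orbT.
Qed.

(** [dcell_uid] is a positional numeral: quotient and remainder by [dcell_size n k] recover the copy
    index and the uid inside the copy. *)
Lemma dcell_uid_surj n k m :
  m < dcell_size n k -> exists x : dcell_vertex n k, dcell_uid x = m.
Proof.
elim: k m => [|k IHk] m /= mt.
  by rewrite /dcell_size card_ord in mt; exists (Ordinal mt).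
rewrite dcell_sizeS in mt.
have t0 : 0 < dcell_size n k by move: mt; case: dcell_size => //; rewrite muln0.
have [x ux] := IHk _ (ltn_pmod m t0).
have ql : m %/ dcell_size n k < (dcell_size n k).+1 by rewrite ltn_divLR.
by exists (Ordinal ql, x) => /=; rewrite ux addnC -divn_eq.
Qed.

Lemma dcell_uid_inj n k : injective (@dcell_uid n k).
Proof.
elim: k => [|k IHk] /=; first exact: val_inj.
move=> [i x] [j y] /= E.
have t0 : 0 < dcell_size n k by apply: leq_trans (dcell_uid_lt x).
have xy : x = y.
  apply: IHk; have := congr1 (modn^~ (dcell_size n k)) E.
  by rewrite ![dcell_uid _ + _]addnC !modnMDl !modn_small ?dcell_uid_lt.
congr (_, _) => //; apply: val_inj; move/eqP: E.
by rewrite xy eqn_add2l eqn_pmul2r // => /eqP.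
Qed.

Lemma dcell_size_ge n k : 1 < n -> n + k <= dcell_size n k.
Proof.
move=> n2; elim: k => [|k IHk]; first by rewrite addn0 /dcell_size card_ord.
rewrite dcell_sizeS; nia.
Qed.

(** Makes a whole copy, with one outgoing edge per vertex, meet the final bound. It fails at [k = 0]
    for [n > 2], whence [k >= 2] in the theorem. *)
Lemma dcell_size_ge2 n k : 1 < n -> 0 < k -> 2 * n + 2 * k - 2 <= dcell_size n k.
Proof.
move=> n2; case: k => // k _; elim: k => [|k IHk].
  by rewrite dcell_sizeS /dcell_size card_ord; nia.
rewrite dcell_sizeS; nia.
Qed.

Lemma dcell_copies_linked n k (i j : 'I_(dcell_size n k).+1) :
  i != j -> exists x y, @dcell n k.+1 (i, x) (j, y).
Proof.
move=> iNj; wlog ij : i j iNj / i < j.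
  move=> H; have [ij|ji] := ltnP i j; first exact: H.
  have [||x [y xy]] := H j i; first by rewrite eq_sym.
    by rewrite ltn_neqAle ji andbT eq_sym.
  by exists y, x; rewrite dcell_sym.
have jt := ltn_ord j.
have [|x ux] := @dcell_uid_surj n k j.-1; first lia.
have [|y uy] := @dcell_uid_surj n k i; first lia.
exists x, y; apply/or3P; apply: Or32; apply/and3P.
by rewrite /= ux uy !eqxx.
Qed.

Lemma dcell_link_exists n k (u : dcell_vertex n k.+1) :
  exists w : dcell_vertex n k.+1, w.1 != u.1 /\ dcell u w.
Proof.
case: u => i x; have xt := dcell_uid_lt x; have it : i < (dcell_size n k).+1 := ltn_ord i.
(* With [m] the uid of [x]: if [m < i], copy [i] is the higher end and the partner has uid [i - 1]
   in copy [m]; otherwise it has uid [i] in copy [m + 1]. *)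
have [mi|im] := ltnP (dcell_uid x) i.
  have [|y uy] := @dcell_uid_surj n k i.-1; first lia.
  have m1 : dcell_uid x < (dcell_size n k).+1 by rewrite ltnS ltnW.
  exists (Ordinal m1, y); split; first by rewrite -val_eqE /= neq_ltn mi.
  by apply/or3P; apply: Or33; apply/and3P; rewrite /= uy !eqxx mi.
have [|y uy] := @dcell_uid_surj n k i; first lia.
have m1 : (dcell_uid x).+1 < (dcell_size n k).+1 by [].
exists (Ordinal m1, y); split; first by rewrite -val_eqE /= neq_ltn ltnS im orbT.
by apply/or3P; apply: Or32; apply/and3P; rewrite /= uy !eqxx ltnS im.
Qed.

Lemma dcell_linkE n k (i j : 'I_(dcell_size n k).+1) (x y : dcell_vertex n k) :
  @dcell_link n k (i, x) (j, y)
  = [&& i < j, dcell_uid x == j.-1 & dcell_uid y == i].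
Proof. by []. Qed.

Lemma dcell_link_uniq n k (u v w : dcell_vertex n k.+1) :
  dcell_link u v || dcell_link v u -> dcell_link u w || dcell_link w u -> v = w.
Proof.
case: u v w => [i x] [j y] [l z]; rewrite !dcell_linkE => hv hw.
have [jl yz] : j = l :> nat /\ dcell_uid y = dcell_uid z.
  move: hv hw; move: (dcell_uid x) (dcell_uid y) (dcell_uid z).
  by move: (nat_of_ord i) (nat_of_ord j) (nat_of_ord l); lia.

by rewrite (val_inj jl) (dcell_uid_inj yz).
Qed.

Lemma dcell_degree_le n k (u : dcell_vertex n k) :
  #|[set v | dcell u v]| <= n + k - 1.
Proof.
elim: k u => [|k IHk] u /=.
  have -> : [set v | u != v] = ~: [set u] by apply/setP => v; rewrite !inE eq_sym.
  by rewrite cardsC1 card_ord; lia.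
(* Subtraction truncates, so adding one link to [n + k - 1] gives [n + k] only when [n + k] is
   positive; the vertex [u] forces this. *)
have n0 : 0 < n + k.
  elim: k u {IHk} => [|k IHk]; first by move=> [] /= _; case: n => // -[].
  lia.
set A := [set pair u.1 y | y in [set y | dcell u.2 y]].
set B := [set v | dcell_link u v || dcell_link v u].
have -> : [set v | (u.1 == v.1) && dcell u.2 v.2 || (dcell_link u v || dcell_link v u)] = A :|: B.
  apply/setP => -[j y]; rewrite !inE /=; congr (_ || _).
  apply/andP/imsetP => [[/eqP<- uy]|[z]]; first by exists y; rewrite ?inE.
  by rewrite inE => uz [-> ->].
rewrite cardsU; apply: leq_trans (leq_subr _ _) _.
have A_le : #|A| <= n + k - 1 by apply: leq_trans (leq_imset_card _ _) (IHk _).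
have B_le : #|B| <= 1.
  apply/card_le1_eqP => v w; rewrite !inE => uv uw.
  exact: dcell_link_uniq uw uv.
by apply: leq_trans (leq_add A_le B_le) _; lia.
Qed.

(** * Splitting a cut along the copies *)

Section Slices.
Variables (n k : nat).
Local Notation t := (dcell_size n k).
Implicit Types (X : {set dcell_vertex n k.+1}) (i j : 'I_t.+1).

Definition slice X i : {set dcell_vertex n k} := [set x | (i, x) \in X].

Definition full_copies X := [set i | slice X i == setT].
Definition empty_copies X := [set i | slice X i == set0].
Definition mixed_copies X := ~: (full_copies X :|: empty_copies X).

Lemma full_empty_disjoint X : 0 < t -> full_copies X :&: empty_copies X = set0.
Proof.
case/card_gt0P=> x _; apply/setP => i; rewrite !inE.
by apply/andP => -[/eqP-> /eqP/setP/(_ x)]; rewrite !inE.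
Qed.

Lemma slice_setC X i : slice (~: X) i = ~: slice X i.
Proof. by apply/setP => x; rewrite !inE. Qed.

Lemma full_copies_setC X : full_copies (~: X) = empty_copies X.
Proof.
by apply/setP => i; rewrite !inE slice_setC -[X in _ == X]setCK setCT (inj_eq (@setC_inj _)).
Qed.

Lemma empty_copies_setC X : empty_copies (~: X) = full_copies X.
Proof. by rewrite -{2}[X]setCK full_copies_setC. Qed.

Lemma cut_pairE X :
  cut (@dcell n k.+1) X =
  \sum_i \sum_j \sum_x \sum_y
    [&& (i, x) \in X, (j, y) \notin X & @dcell n k.+1 (i, x) (j, y)].
Proof.
rewrite [LHS](@sum_pair 'I_t.+1 (dcell_vertex n k)).
apply: eq_bigr => i _; rewrite [RHS]exchange_big; apply: eq_bigr => x _.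
exact: (@sum_pair 'I_t.+1 (dcell_vertex n k)).
Qed.

Lemma dcell_copyE i x y : @dcell n k.+1 (i, x) (i, y) = dcell x y.
Proof. by rewrite /= eqxx /dcell_link /= ltnn !orbF. Qed.

Local Arguments dcell : simpl never.
Local Arguments dcell_vertex : simpl never.

Lemma cut_slices X : 0 < t ->
  \sum_i cut (@dcell n k) (slice X i) + #|full_copies X| * #|empty_copies X|
    <= cut (@dcell n k.+1) X.
Proof.
move=> t0; rewrite cut_pairE.
have -> : #|full_copies X| * #|empty_copies X| =
    \sum_i \sum_j ((i \in full_copies X) && (j \in empty_copies X)).
  rewrite -sum1_card big_distrl [LHS]big_mkcond /=; apply: eq_bigr => i _.
  case: ifP => _ /=; last by rewrite big1.
  by rewrite mul1n -sum1_card big_mkcond; apply: eq_bigr => j _; case: ifP.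
rewrite -big_split; apply: leq_sum => i _ /=.
(* The diagonal term is the cut inside copy [i]; the other terms supply one link for each full-empty
   pair. *)
rewrite (bigD1 i) //= [X in _ <= X](bigD1 i) //= addnA; apply: leq_add.
  rewrite -in_setI full_empty_disjoint // in_set0 addn0.
  apply/eq_leq/eq_bigr => x _; apply: eq_bigr => y _.
  by rewrite dcell_copyE !inE.
apply: leq_sum => j ji; rewrite !inE; case: eqP => //= iT; case: eqP => // j0.
have [|x [y xy]] := @dcell_copies_linked n k i j; first by rewrite eq_sym.
rewrite (bigD1 x) //= (bigD1 y) //= xy.
have -> : (i, x) \in X by have := in_setT x; rewrite -iT inE.
suff -> : (j, y) \notin X by [].
by apply/negP => jy; have := in_set0 y; rewrite -j0 inE jy.
Qed.

(** The link of each vertex of [X] leads to another copy, hence out of [X]. *)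
Lemma cut_inside X i :
  (forall u, u \in X -> u.1 = i) ->
  cut (@dcell n k) (slice X i) + #|slice X i| <= cut (@dcell n k.+1) X.
Proof.
move=> Xi; rewrite cut_pairE (bigD1 i) //=; apply: leq_trans (leq_addr _ _).
rewrite exchange_big /= -sum1_card [X in _ + X]big_mkcond -big_split.
apply: leq_sum => x _ /=; rewrite (bigD1 i) //=; apply: leq_add.
  by apply/eq_leq/eq_bigr => y _; rewrite dcell_copyE !inE.
rewrite inE; case: ifP => // ix.
have [[j y] /= [ji xy]] := @dcell_link_exists n k (i, x).
rewrite (bigD1 j) //= (bigD1 y) //=.
suff -> : (j, y) \notin X by rewrite xy.
by apply: contra ji => /Xi /= ->.
Qed.

Lemma card_slice_inside X i :
  (forall u, u \in X -> u.1 = i) -> #|slice X i| = #|X|.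
Proof.
move=> Xi; rewrite -(card_imset _ (_ : injective (pair i))) => [|x y []//].
congr #|pred_of_set _|; apply/setP => -[j x]; apply/imsetP/idP.
  by move=> [y]; rewrite inE => yX [-> ->].
by move=> jx; have /= <- := Xi _ jx; exists x; rewrite // inE.
Qed.

Lemma full_copy_card X i : i \in full_copies X -> t <= #|X|.
Proof.
rewrite inE => /eqP iT.
rewrite -[t]cardsT -iT -(card_imset _ (_ : injective (pair i))) => [|x y []//].
by apply/subset_leq_card/subsetP => _ /imsetP[x + ->]; rewrite inE.
Qed.

(** Without full copies, every copy that [X] meets is mixed. *)
Lemma no_full_copy_inside X i :
  full_copies X = set0 -> mixed_copies X \subset [set i] ->
  forall u, u \in X -> u.1 = i.
Proof.
move=> f0 Mi [j x] jx /=; apply/set1P/(subsetP Mi).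
rewrite /mixed_copies f0 set0U !inE; apply/eqP => j0.
by have := in_set0 x; rewrite -j0 inE jx.
Qed.

(** The case split shared by all lower bounds, with [c] a bound for cuts inside a copy. The conjunct
    on the size of [X] rules out the first case for small sets. *)
Lemma cut_cases c X : 0 < t ->
  (forall Y, Y != set0 -> Y != setT -> c <= cut (@dcell n k) Y) ->
  [\/ t <= #|X| /\ (t <= cut (@dcell n k.+1) X \/
                    t.-1 + c <= cut (@dcell n k.+1) X /\ 1 < t),
      2 * c <= cut (@dcell n k.+1) X,
      exists i, forall u, u \in X -> u.1 = i
    | exists i, forall u, u \in ~: X -> u.1 = i].
Proof.
move=> t0 Hc; have cutX := cut_slices X t0.
have McE : #|mixed_copies X| * c <= \sum_i cut (@dcell n k) (slice X i).
  rewrite -sum1_card big_distrl big_mkcond /=; apply: leq_sum => i _.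
  by case: ifP => //; rewrite mul1n !inE => /norP[iT i0]; apply: Hc.
have sumE : #|full_copies X| + #|empty_copies X| + #|mixed_copies X| = t.+1.
  rewrite -cardsUI full_empty_disjoint // cards0 addn0 -[RHS]card_ord.
  exact: cardsC.
have [M1|M2] := leqP #|mixed_copies X| 1; last by apply: Or42; nia.
have [i Mi] : exists i, mixed_copies X \subset [set i].
  have [->|[i iM]] := set_0Vmem (mixed_copies X).
    by exists ord0; apply: sub0set.
  by exists i; apply/subsetP => j jM; rewrite inE (card_le1_eqP M1 j i).
have [f0|[j jf]] := set_0Vmem (full_copies X).
  by apply: Or43; exists i; apply: no_full_copy_inside.
have [e0|[l le]] := set_0Vmem (empty_copies X).
  apply: Or44; exists i; apply: no_full_copy_inside.
    by rewrite full_copies_setC.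
  by rewrite /mixed_copies full_copies_setC empty_copies_setC setUC.
apply: Or41; split; first exact: full_copy_card jf.
have f1 : 0 < #|full_copies X| by apply/card_gt0P; exists j.
have e1 : 0 < #|empty_copies X| by apply/card_gt0P; exists l.
(* For positive [f] and [g], [f * g >= f + g - 1]; the full and empty copies number [t + 1] in
   total, or [t] beside one mixed copy. *)
case: (posnP #|mixed_copies X|) => M0; [left | right]; nia.
Qed.
End Slices.

(** * Lower bounds for cuts of DCell *)

Section Bounds.
Variable n : nat.
Hypothesis n_gt1 : 1 < n.

Lemma cut_complete (X : {set dcell_vertex n 0}) :
  cut (@dcell n 0) X = #|X| * (n - #|X|).
Proof.
rewrite cut_card.
have -> : [set p : 'I_n * 'I_n | [&& p.1 \in X, p.2 \notin X & @dcell n 0 p.1 p.2]]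
          = setX X (~: X).
  apply/setP => -[x y]; rewrite !inE /=; case: (boolP (x \in X)) => //= xX.
  by case: (boolP (y \in X)) => //= yX; apply: contraNneq yX => <-.
by rewrite cardsX [#|~: X|]cardsCs setCK card_ord.
Qed.

Lemma dcell_edge_connectivity k (X : {set dcell_vertex n k}) :
  X != set0 -> X != setT -> n + k - 1 <= cut (@dcell n k) X.
Proof.
elim: k X => [|k IHk] X X0 XT.
  rewrite cut_complete; have := X0; have := XT.
  rewrite -card_gt0 -subTset => /subsetPn[x _ xX].
  have : #|X| < n by rewrite -[X in _ < X]card_ord -cardsT proper_card // properT.
  by move=> *; nia.
have t_ge := dcell_size_ge k n_gt1.
have inside (Y : {set dcell_vertex n k.+1}) i :
    (forall u, u \in Y -> u.1 = i) -> Y != set0 ->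
    n + k.+1 - 1 <= cut (@dcell n k.+1) Y.
  move=> Yi Y0; have := cut_inside Yi.
  have Y1 : 0 < #|slice Y i| by rewrite (card_slice_inside Yi) card_gt0.
  have [YT|YT] := eqVneq (slice Y i) setT.
    by rewrite YT cardsT -/(dcell_size n k); lia.
  have := IHk _ _ YT; rewrite -card_gt0 => /(_ Y1); lia.
have [||[_ [|[]]]||[i Xi]|[i Xi]] := @cut_cases n k (n + k - 1) X; try lia.
- exact: IHk.
- exact: inside Xi X0.
- rewrite -cut_setC; last exact: dcell_sym.
  by apply: inside Xi _; rewrite -setCT (inj_eq (@setC_inj _)).
Qed.

(* The term #|Y| absorbs the level k+1 edges leaving Y when Y lies inside one
   copy of the next level; without it the induction would fail at k = 1, where
   the boundary of a copy of K_n has only n edges. *)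
Lemma cut_add_card k (Y : {set dcell_vertex n k}) :
  1 < #|Y| -> Y != setT -> 2 * n + 2 * k - 2 <= cut (@dcell n k) Y + #|Y|.
Proof.
elim: k Y => [|k IHk] Y Y2 YT.
  (* With [m = #|Y|] between 2 and [n - 1], the sum is [m * (n + 1 - m)], least at both ends, where
     it equals [2n - 2]. *)
  rewrite cut_complete.
  have : #|Y| < n by rewrite -[X in _ < X]card_ord -cardsT proper_card // properT.
  by move=> *; nia.
have t_ge := dcell_size_ge k n_gt1.
have Y0 : Y != set0 by rewrite -card_gt0 ltnW.
have L := dcell_edge_connectivity Y0 YT.
(* A set of at least [n + k] vertices is settled by the edge connectivity [n + k] at this level. *)
have [Y_ge|Y_lt] := leqP (n + k) #|Y|; first lia.
have [||[]||[i Yi]|[i Yi]] := @cut_cases n k (n + k - 1) Y; try lia.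
- exact: dcell_edge_connectivity.
(* The links contribute a further [#|Y| >= 2], the increment of the bound from [k] to [k.+1]. *)
- have := cut_inside Yi; have := IHk (slice Y i).
  rewrite (card_slice_inside Yi) => /(_ Y2) H.
  have : slice Y i != setT.
    apply: contraTneq Y_lt => sliceT.
    by rewrite -leqNgt -(card_slice_inside Yi) sliceT cardsT.
  by move/H; lia.
(* Here [Y] contains all copies but one, so it has at least [t * t] vertices, against [Y_lt]. *)
- have := card_slice_inside Yi; have := max_card (slice (~: Y) i).
  have := cardsC Y; rewrite -[#|{: dcell_vertex n k.+1}|]/(dcell_size n k.+1).
  rewrite dcell_sizeS -[#|dcell_vertex n k|]/(dcell_size n k); nia.
Qed.

(** The bound is exactly twice the edge connectivity [n + k - 1] of a copy, so two mixed copies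
    reach it. *)
Lemma cut_restricted k (X : {set dcell_vertex n k.+1}) : 0 < k ->
  1 < #|X| -> 1 < #|~: X| -> 2 * n + 2 * k - 2 <= cut (@dcell n k.+1) X.
Proof.
move=> k0 X2 XC2; have t_ge := dcell_size_ge k n_gt1.
have t_ge2 := dcell_size_ge2 n_gt1 k0.
have inside (Y : {set dcell_vertex n k.+1}) i :
    (forall u, u \in Y -> u.1 = i) -> 1 < #|Y| ->
    2 * n + 2 * k - 2 <= cut (@dcell n k.+1) Y.
  move=> Yi Y2; have := cut_inside Yi.
  have [YT|YT] := eqVneq (slice Y i) setT.
    by rewrite YT cardsT -/(dcell_size n k); lia.
  by have := cut_add_card _ YT; rewrite (card_slice_inside Yi) => /(_ Y2); lia.
have [||[_ [|[]]]||[i Xi]|[i Xi]] := @cut_cases n k (n + k - 1) X; try lia.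
- exact: dcell_edge_connectivity.
- exact: inside Xi X2.
- by rewrite -cut_setC; [exact: inside Xi XC2 | exact: dcell_sym].
Qed.

(** The edges at a vertex form a cut, so edge connectivity bounds the degree. *)
Lemma dcell_degree_ge k (u : dcell_vertex n k) :
  n + k - 1 <= #|[set v | dcell u v]|.
Proof.
rewrite -cut_set1; last exact: dcell_irr.
have u0 : [set u] != set0 by rewrite -card_gt0 cards1.
apply: dcell_edge_connectivity => //; apply: contraTneq (dcell_size_ge k n_gt1) => uT.
by rewrite /dcell_size -cardsT -uT cards1; lia.
Qed.

End Bounds.

(** * The restricted edge-connectivity *)

Theorem theorem6 (n k : nat) (hn : 2 <= n) (hk : 2 <= k) :
  restricted_edge_connectivity_is (@dcell n k) 2 (2 * n + 2 * k - 4).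
Proof.
case: k hk => // k; rewrite ltnS => k0.
have lower F : restricted_edge_cut (@dcell n k.+1) 2 F ->
    2 * n + 2 * k.+1 - 4 <= #|F|.
  move=> [_ [u [v uv]] comp2]; apply: leq_trans (cut_component (@dcell n k.+1) F u).
  have -> : 2 * n + 2 * k.+1 - 4 = 2 * n + 2 * k - 2 by lia.
  (* The component of [v] lies in the complement of that of [u]. *)
  apply: cut_restricted => //; apply: leq_trans (comp2 v) _.
  apply/subset_leq_card/subsetP => w; rewrite !inE => vw.
  apply: contra uv => uw; apply: connect_trans uw _.
  by rewrite sym_connect_sym //; apply: edge_delete_sym; apply: dcell_sym.
split=> //.
have [x _] : exists x : dcell_vertex n k.+1, dcell_uid x = 0.
  by apply: dcell_uid_surj; have := dcell_size_ge k.+1 hn; lia.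
have [y xy] : exists y, dcell x y.
  suff /card_gt0P[y] : 0 < #|[set y | dcell x y]| by rewrite inE; exists y.
  by have := dcell_degree_ge hn x; lia.
have xNy : x != y by apply: contraTneq xy => ->; rewrite dcell_irr.
set X := [set x; y]; set F := boundary (@dcell n k.+1) X.
have cutF : restricted_edge_cut (@dcell n k.+1) 2 F.
  (* Degrees are at least [n + k >= 3], more than the two vertices of [X]. *)
  have out w : exists2 z, z \notin X & dcell w z.
    have := dcell_degree_ge hn w => deg.
    have /subsetPn[z] : ~~ ([set z | dcell w z] \subset X).
      apply/negP => /subset_leq_card; rewrite cards2 xNy => le2.
      by have := leq_trans deg le2; lia.
    by rewrite inE => wz zX; exists z.
  split.
  - apply/subsetP => E /imsetP[p]; rewrite inE => /and3P[_ _ p_edge] ->.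
    by apply/imsetP; exists p; rewrite ?inE.
  - have [z zX _] := out x; exists x, z; apply: contra zX => xz.
    have /subsetP := component_edge_delete_boundary (@dcell_sym n k.+1) (set21 x y).
    by apply; rewrite inE.
  (* An edge with both ends on the same side of [X] survives the deletion. *)
  - have kept w z : dcell w z -> (w \in X) = (z \in X) ->
        1 < #|component (edge_delete (@dcell n k.+1) F) w|.
      move=> wz wzX; apply: (@card_component_gt1 _ _ _ z).
        by apply: contraTneq wz => ->; rewrite dcell_irr.
      apply/andP; split=> //.
      by apply/negP => /mem_boundary; rewrite wzX eqxx.
    move=> w; have [|wX] := boolP (w \in X); last first.
      by have [z zX wz] := out w; apply: kept wz _; rewrite (negPf wX) (negPf zX).
    case/set2P=> ->; first by apply: kept xy _; rewrite set21 set22.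
    by apply: (kept _ x); rewrite ?set21 ?set22 // dcell_sym.
exists F; split=> //; apply/eqP; rewrite eqn_leq lower // andbT card_boundary.
(* Both ends have degree at most [n + k], so the boundary has at most [2(n + k) - 2] edges. *)
have := cut_edge (@dcell_sym n k.+1) (@dcell_irr n k.+1) xy.
have := dcell_degree_le x; have := dcell_degree_le y.
move: (cut _ _) #|_| #|_| => a b c; lia.
Qed.
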